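(* Let $p$ be an odd prime and let $G$ be a minimal $cl_p$ group. Then $G$ is a simple group.
   Context: For a prime $p$, a finite group $G$ is called a $cl_p$ group if the Sylow $p$-subgroups of $G$ are non-abelian and, for every $p$-element $x\in G$ (element of $p$-power order), the size of the conjugacy class of $x$ in $G$ is not divisible by $p$. A finite group $G$ is called a minimal $cl_p$ group if $G$ is $cl_p$ but no proper normal subgroup of $G$ and no proper quotient group of $G$ (that is, no $G/N$ with $1\neq N\lhd G$) is $cl_p$. *)

(* Defs.v *)
From mathcomp Require Import all_boot all_fingroup all_solvable.

Set Implicit Arguments.
Unset Strict Implicit.
Unset Printing Implicit Defensive.

Local Open Scope group_scope.

Definition cl_p (p : nat) (gT : finGroupType) (G : {group gT}) : Prop :=
  (forall P : {group gT}, p.-Sylow(G) P -> ~~ abelian P) /\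
  (forall x : gT, x \in G -> p.-elt x -> ~~ (p %| #|x ^: G|)%N).

Definition minimal_cl_p (p : nat) (gT : finGroupType) (G : {group gT}) : Prop :=
  [/\ cl_p p G,
      forall N : {group gT}, N <| G -> N \proper G -> ~ cl_p p N
    & forall N : {group gT}, N <| G -> N :!=: 1 -> ~ cl_p p (G / N)%G].

(* Main.v *)
(** Every proper nontrivial normal subgroup N of G inherits the class size
    condition, as does G / N, so by minimality the Sylow p-subgroups of N and of
    G / N are abelian: for P Sylow in G and T = P :&: N, T is abelian and
    P' is contained in T.  Every p-element of G centralises a Sylow subgroup of
    G, hence one of N, hence lies in N * 'C_G(T ^ g) = N * 'C_G(T) for some g in
    N; so 'C_G(T) has index prime to p, and T is central in P.  Now let x be in
    P and A = <x> T, an abelian group that P normalises since P' <= T <= A.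
    Conjugating inside 'C_N(x), a Sylow subgroup Q of G centralising x can be
    chosen with Q :&: N = T, so that Q centralises A.  Thus 'C(A) contains a
    Sylow subgroup of 'N(A), and being normal in 'N(A) it contains P: so P is
    abelian, a contradiction. *)
Require Import Defs.
From mathcomp Require Import all_boot all_fingroup all_solvable.

Set Implicit Arguments.
Unset Strict Implicit.
Unset Printing Implicit Defensive.

Local Open Scope group_scope.

(** The class size is the index of ['C_G[x]], which is prime to [p] exactly when a Sylow
    [p]-subgroup of ['C_G[x]] is already Sylow in [G]. *)
Lemma p'_classP (p : nat) (gT : finGroupType) (G : {group gT}) (x : gT) :
    prime p ->
  reflect (exists2 Q : {group gT}, p.-Sylow(G) Q & x \in 'C(Q))
          (~~ (p %| #|x ^: G|)%N).
Proof.
move=> p_pr; rewrite -index_cent1 -p'natE //.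
apply: (iffP idP) => [p'iC | [Q sylQ cQx]].
  have [Q sylQ] := Sylow_exists p 'C_G[x].
  exists Q; last by rewrite -sub_cent1 (subset_trans (pHall_sub sylQ)) ?subsetIr.
  have [sQC pQ p'iQ] := and3P sylQ; apply/and3P; split=> //.
    exact: subset_trans sQC (subsetIl _ _).
  by rewrite -(Lagrange_index (subsetIl G 'C[x]) sQC) pnatM p'iC.
have [sQG _ p'iQ] := and3P sylQ; apply: pnat_dvd p'iQ; apply: indexgS.
by rewrite subsetI sQG sub_cent1.
Qed.

Lemma p'_class_normal (p : nat) (gT : finGroupType) (G N : {group gT}) (x : gT) :
  prime p -> N <| G -> ~~ (p %| #|x ^: G|)%N -> ~~ (p %| #|x ^: N|)%N.
Proof.
move=> p_pr nsNG /(p'_classP _ _ p_pr)[Q sylQ cQx]; apply/p'_classP=> //.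
exists (Q :&: N)%G; first exact: Hall_setI_normal sylQ.
exact: subsetP (centS (subsetIl Q N)) x cQx.
Qed.

Lemma p'_class_quotient (p : nat) (gT : finGroupType) (G N : {group gT})
    (u : coset_of N) :
    prime p -> N <| G ->
    (forall x, x \in G -> p.-elt x -> ~~ (p %| #|x ^: G|)%N) ->
  u \in G / N -> p.-elt u -> ~~ (p %| #|u ^: (G / N)|)%N.
Proof.
move=> p_pr nsNG clG /morphimP[x Nx Gx ->{u}] p_xbar.
(* The preimage [x] of a [p]-element need not be one; its [p]-part is, and has the same image. *)
have Gxp : x.`_p \in G by rewrite groupX.
have /(p'_classP _ _ p_pr)[Q sylQ cQx] := clG _ Gxp (p_elt_constt p x).
have nNQ : Q \subset 'N(N) := subset_trans (pHall_sub sylQ) (normal_norm nsNG).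
apply/p'_classP=> //; exists (Q / N)%G; first exact: quotient_pHall.
rewrite -(constt_p_elt p_xbar) -morph_constt //.
by rewrite (subsetP (quotient_cent _ _)) // mem_quotient.
Qed.

Lemma Sylow_centralised_setI_normal (p : nat) (gT : finGroupType)
    (G N P : {group gT}) :
    prime p -> N <| G ->
    (forall x, x \in G -> p.-elt x -> ~~ (p %| #|x ^: G|)%N) ->
    abelian (P :&: N) ->
  p.-Sylow(G) P -> P \subset 'C(P :&: N).
Proof.
move=> p_pr nsNG clG cTT sylP; set T := (P :&: N)%G; set C := 'C_G(T)%G.
have [sNG nNG] := andP nsNG; have [sPG pP p'iP] := and3P sylP.
have sylT : p.-Sylow(N) T by apply: Hall_setI_normal sylP.
have sCG : C \subset G by apply: subsetIl.
have nNC : C \subset 'N(N) := subset_trans sCG nNG.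
have sTC : T \subset C.
  by rewrite subsetI (subset_trans (subsetIl P N) sPG); exact: cTT.
have sPCN : P \subset C <*> N.
  apply/subsetP=> x Px; have Gx := subsetP sPG x Px.
  have /(p'_classP _ _ p_pr)[Q sylQ cQx] := clG x Gx (mem_p_elt pP Px).
  (* Since [Q :&: N] is [T :^ n], conjugation by the inverse of [n] takes [x] into [C]. *)
  have [n Nn defQN] := Sylow_trans sylT (Hall_setI_normal nsNG sylQ).
  have CNn : n \in C <*> N by rewrite mem_gen // inE Nn orbT.
  rewrite -(groupJr x (groupVr CNn)); apply: (subsetP (joing_subl _ _)).
  have Gn := subsetP sNG n Nn.
  apply/setIP; split; first by rewrite groupJr ?groupV.
  by rewrite -mem_conjg -centJ -defQN (subsetP (centS (subsetIl Q N))).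
have p'iC : p^'.-nat #|G : C|.
  (* The index splits at [C <*> N]: the upper factor divides [#|G : P|], and the lower one is
     [#|N : N :&: C|], a divisor of [#|N : T|] because [T] is abelian. *)
  rewrite -(@Lagrange_index _ _ (C <*> N)) ?joing_subl ?join_subG ?sCG // pnatM.
  rewrite (pnat_dvd (indexgS _ sPCN) p'iP) /= norm_joinEl // indexMg -indexgI /=.
  have [_ _] := and3P sylT; apply: pnat_dvd; apply: indexgS.
  by rewrite subsetI subsetIr.
(* [R] is Sylow in [G] and contains the normal [p]-subgroup [T] of [C], so [R] centralises
   [R :&: N = T]; conjugating [R] to [P] transfers this to [P]. *)
have [R sylR] := Sylow_exists p C; have [sRC pR p'iR] := and3P sylR.
have sylRG : p.-Sylow(G) R.
  rewrite /pHall (subset_trans sRC sCG) pR.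
  by rewrite -(Lagrange_index sCG sRC) pnatM p'iC.
have nsTC : T <| C.
  by rewrite /normal sTC cents_norm ?subsetIr.
have pT : p.-group T by apply: pgroupS (subsetIl _ _) pP.
have sTR : T \subset R := normal_sub_max_pgroup (Hall_max sylR) pT nsTC.
have defT : R :&: N = T.
  apply: sub_pHall sylT _ _ (subsetIr _ _); first exact: pgroupS (subsetIl _ _) pR.
  by rewrite subsetI sTR subsetIr.
have [g Gg ->] := Sylow_trans sylRG sylP.
rewrite -(normsP nNG g Gg) -conjIg centJ conjSg defT.
exact: subset_trans sRC (subsetIr _ _).
Qed.

Lemma abelian_Sylow_extension (p : nat) (gT : finGroupType)
    (G N P : {group gT}) :
    prime p -> N <| G ->
    (forall x, x \in G -> p.-elt x -> ~~ (p %| #|x ^: G|)%N) ->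
    p.-Sylow(G) P -> abelian (P :&: N) -> abelian (P / N) ->
  abelian P.
Proof.
move=> p_pr nsNG clG sylP cTT cPNPN.
have [sNG nNG] := andP nsNG; have [sPG pP _] := and3P sylP.
have cTP := Sylow_centralised_setI_normal p_pr nsNG clG cTT sylP.
have nNP : P \subset 'N(N) := subset_trans sPG nNG.
have sP'T : P^`(1) \subset P :&: N.
  by rewrite subsetI der_sub -quotient_cents2.
apply/centsP=> y Py x Px; apply/cent1P; apply: subsetP y Py.
have Gx := subsetP sPG x Px.
have /(p'_classP _ _ p_pr)[Q sylQ cQx] := clG x Gx (mem_p_elt pP Px).
have sylInC (R : {group gT}) : p.-Sylow(G) R -> R :&: N \subset 'C[x] ->
    p.-Sylow('C_N[x]) (R :&: N).
  move=> sylR cxR; apply: pHall_subl (Hall_setI_normal nsNG sylR).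
    by rewrite subsetI subsetIr.
  exact: subsetIl.
have cxT : P :&: N \subset 'C[x].
  by rewrite sub_cent1 (subsetP cTP).
have cxQ : Q \subset 'C[x] by rewrite sub_cent1.
(* Taking [m] in ['C_N[x]] moves [Q :&: N] onto [P :&: N] while [Q :^ m] still centralises [x]. *)
have [m /setIP[Nm cxm] defT] :=
  Sylow_trans (sylInC Q sylQ (subset_trans (subsetIl _ _) cxQ))
              (sylInC P sylP cxT).
have Gm := subsetP sNG m Nm.
pose R := (Q :^ m)%G.
have sylR : p.-Sylow(G) R by rewrite pHallJ.
have defRN : R :&: N = P :&: N.
  by rewrite [RHS]defT conjIg (conjGid Nm).
have cxR : R \subset 'C[x] by rewrite -(conjGid cxm) conjSg.
have cTR : R \subset 'C(P :&: N).
  by rewrite -defRN (Sylow_centralised_setI_normal p_pr nsNG) ?defRN.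
pose A := (<[x]> <*> (P :&: N))%G.
have cAR : R \subset 'C(A).
  by rewrite centY cent_cycle subsetI cxR.
have sAP : A \subset P by rewrite join_subG cycle_subG Px subsetIl.
have nAP : P \subset 'N_G(A).
  rewrite subsetI sPG sub_der1_norm //.
  exact: subset_trans sP'T (joing_subr _ _).
have sylRN : p.-Sylow('N_G(A)) R.
  apply: pHall_subl (subsetIl _ _) (sylR).
  by rewrite subsetI (pHall_sub sylR) cents_norm.
(* As [g] normalises [A], it normalises ['C(A)], so [R :^ g], and with it [P], stays inside
   ['C(A)]. *)
have [g /setIP[_ nAg] sPRg] := Sylow_subJ sylRN nAP pP.
have sCAx : 'C(A) \subset 'C[x] by rewrite -cent_cycle centS ?joing_subl.
apply: subset_trans sPRg (subset_trans _ sCAx).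
by rewrite -(normP nAg) centJ conjSg.
Qed.

Lemma nonabelian_Sylow (p : nat) (gT : finGroupType) (G P : {group gT}) :
    p.-Sylow(G) P -> ~~ abelian P ->
  forall Q : {group gT}, p.-Sylow(G) Q -> ~~ abelian Q.
Proof. by move=> sylP nabP Q /(Sylow_trans sylP)[x _ ->]; rewrite abelianJ. Qed.

Theorem theorem4p1 (p : nat) (gT : finGroupType) (G : {group gT})
  (p_pr : prime p) (p_odd : odd p) (minG : minimal_cl_p p G) : simple G.
Proof.
have [[nabG clG] minN minQ] := minG.
have [P sylP] := Sylow_exists p G; have sPG := pHall_sub sylP.
have nabP := nabG P sylP.
apply/simpleP; split=> [|N nsNG].
  by apply: contraNneq nabP => G1; rewrite (abelianS sPG) // G1 abelian1.
have [-> | ntN] := eqVneq N 1%G; first by left.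
have [-> | neqNG] := eqVneq N G; [by right | case/negP: nabP].
have prNG : N \proper G.
  rewrite properEneq (normal_sub nsNG) andbT.
  by apply: contraNneq neqNG => /val_inj->.
have nNP : P \subset 'N(N) := subset_trans sPG (normal_norm nsNG).
(* If [P :&: N] or [P / N] were non-abelian, then [N] or [G / N] respectively would be [cl_p],
   against minimality. *)
apply: (abelian_Sylow_extension p_pr nsNG clG sylP); apply: contraT => nab.
  case: (minN N nsNG prNG); split=> [|x Nx p_x].
    exact: nonabelian_Sylow (Hall_setI_normal nsNG sylP) nab.
  by apply: (p'_class_normal p_pr nsNG); rewrite clG ?(subsetP (normal_sub nsNG)).
case: (minQ N nsNG ntN); split=> [|u Gu p_u].
  exact: nonabelian_Sylow (quotient_pHall nNP sylP) nab.
exact: p'_class_quotient p_u.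
Qed.
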